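(* Let $n\ge 2$ be an integer and let $x,y$ be complex numbers such that no denominator below vanishes, i.e. $x\notin\{-1,\dots,-n\}$, $x-y\notin\{-1,\dots,-n\}$, $1+x-y+ny\ne0$ and $y\notin\{-n,-n+1,\dots,n-1\}$. Then $$\sum_{k=0}^n(-1)^k\binom{n}{k}\frac{\binom{y+k}{k}}{\binom{y-n+k}{k}}\frac{(y-1)y}{(y+k-1)(y+k)}H_{k}^{\langle3\rangle}(x)=\frac{(-1)^n(1+x-y+ny)}{2n(n-1)(1+x-y)}\,\frac{\binom{x-y+n}{n}}{\binom{x+n}{n}\binom{y}{n}}\{A_n(x,y)+B_n(x,y)\},$$ where $$A_n(x,y)=\big[H_{n}^{\langle2\rangle}(x)-H_{n}^{\langle2\rangle}(x-y)\big]+\frac{2ny}{(1+x-y)^2(1+x-y+ny)},$$ $$B_n(x,y)=\big[H_{n}(x)-H_{n}(x-y)\big]\bigg[H_{n}(x)-H_{n}(x-y)+\frac{2ny}{(1+x-y)(1+x-y+ny)}\bigg].$$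
   Context: For a complex number $u$ and an integer $k\ge 0$, $\binom{u}{k}=\frac{u(u-1)\cdots(u-k+1)}{k!}$ (equal to $1$ for $k=0$). For a complex number $u$ and a positive integer $\ell$, the generalized harmonic numbers of $\ell$-order are $H_0^{\langle\ell\rangle}(u)=0$ and $H_n^{\langle\ell\rangle}(u)=\sum_{k=1}^n\frac{1}{(u+k)^\ell}$ for $n\ge1$; $H_n(u)=H_n^{\langle1\rangle}(u)$. *)

(* Defs.v *)
From mathcomp Require Import all_boot all_order all_algebra.
From mathcomp Require Import reals complex.

Set Implicit Arguments.
Unset Strict Implicit.
Unset Printing Implicit Defensive.

Import Order.TTheory GRing.Theory Num.Theory.
Local Open Scope ring_scope.

Definition gbinom (F : numFieldType) (u : F) (k : nat) : F :=
  (\prod_(i < k) (u - i%:R)) / (k`!)%:R.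

(* [gharm l n u] is the generalized harmonic number H_n^<l>(u). *)
Definition gharm (F : numFieldType) (l n : nat) (u : F) : F :=
  \sum_(1 <= k < n.+1) 1 / (u + k%:R) ^+ l.

Definition A_term (F : numFieldType) (n : nat) (x y : F) : F :=
  (gharm 2 n x - gharm 2 n (x - y))
  + (2%:R * n%:R * y) / ((1 + x - y) ^+ 2 * (1 + x - y + n%:R * y)).

Definition B_term (F : numFieldType) (n : nat) (x y : F) : F :=
  (gharm 1 n x - gharm 1 n (x - y))
  * (gharm 1 n x - gharm 1 n (x - y)
     + (2%:R * n%:R * y) / ((1 + x - y) * (1 + x - y + n%:R * y))).

(* Main.v *)
(* Write n = m + 2.  The summand without its harmonic factor is
   c_k = (-1)^k C(n,k) (y-1)_k / (y-n+1)_k, which is Gosper-summable, so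
   summation by parts turns the left-hand side into
   sum_(i < n) t_i / (x+i+1)^3 with explicit tails t_i.  Put
   P(X) = (1+X-y+ny) prod_(2 <= j <= n) (X-y+j) and
   Q(X) = prod_(1 <= j <= n) (X+j).  Up to a constant, t_i is the residue of
   P/Q at -(i+1), so the sum is, up to a constant, half the second derivative
   of P/Q at x.  As P and Q split into linear factors, that derivative is
   P/Q times an expression in the logarithmic derivatives of P and Q, which
   are harmonic numbers of x-y and x. *)
Require Import Defs.
From mathcomp Require Import all_boot all_order all_algebra.
From mathcomp Require Import reals complex.
From mathcomp Require Import ring zify.

Set Implicit Arguments.
Unset Strict Implicit.
Unset Printing Implicit Defensive.

Import Order.TTheory GRing.Theory Num.Theory.
Local Open Scope ring_scope.
Local Open Scope complex_scope.

(** * Logarithmic derivatives and partial fractions *)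

(** Here [h 1] is p'/p, and its derivative is -[h 2], so p''/p = [h 1]^2 - [h 2]. The predicate [A]
    lets the lemma cover products with one factor left out. *)
Lemma horner_deriv_prod_XsubC (F : fieldType) (I : Type) (r : seq I)
    (A : pred I) (a : I -> F) (x : F) :
    (forall i, A i -> x - a i != 0) ->
  let p := \prod_(i <- r | A i) ('X - (a i)%:P) in
  let h l := \sum_(i <- r | A i) (x - a i) ^- l in
  p^`().[x] = p.[x] * h 1%N
  /\ p^`()^`().[x] = p.[x] * (h 1%N ^+ 2 - h 2%N).
Proof.
move=> xa p h; rewrite {}/p {}/h.
elim: r => [|i r [IH1 IH2]].
  by rewrite !big_nil derivC deriv0 !horner0 expr0n subr0 !mulr0.
rewrite !big_cons; case: ifP => // Ai.
have s0 := xa i Ai.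
rewrite !(derivM, derivD, derivN, derivX, derivC) subr0 mul1r.
rewrite !hornerE IH1 IH2 /= expr1.
move: (\prod_(j <- r | A j) _).[x] (x - a i) s0 => q s s0.
by split; field.
Qed.

(** Lagrange interpolation: the two sides agree at the n distinct points [a j], and their difference
    has degree below n because the monic leading terms cancel. Divided by the product Q, this is P/Q
    = 1 + a sum of simple poles. *)
Lemma partial_fractions_monic (F : fieldType) (n : nat) (a : 'I_n -> F)
    (P : {poly F}) :
    injective a -> P \is monic -> size P = n.+1 ->
  P = \prod_(i < n) ('X - (a i)%:P)
      + \sum_(j < n) (P.[a j] / \prod_(i < n | i != j) (a j - a i))
                     *: \prod_(i < n | i != j) ('X - (a i)%:P).
Proof.
move=> inj_a monP sizeP.
set Q := \prod_(i < n) _; pose Qd j := \prod_(i < n | i != j) ('X - (a i)%:P).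
have QdE i j : (Qd j).[a i]
    = if i == j then \prod_(k < n | k != j) (a j - a k) else 0.
  rewrite horner_prod; case: eqP => [->|/eqP ij].
    by apply: eq_bigr => k _; rewrite !hornerE.
  by rewrite (bigD1 i) //= !hornerE subrr mul0r.
have sizeQ : size Q = n.+1.
  by rewrite size_prod_XsubC /index_enum -enumT size_enum_ord.
have monQ : Q \is monic by apply: monic_prod_XsubC.
apply/eqP; rewrite -subr_eq0 opprD addrA; apply/eqP.
apply: (@roots_geq_poly_eq0 _ _ [seq a i | i <- enum 'I_n]).
- apply/allP => _ /mapP[i _ ->]; rewrite /root !hornerD !hornerN horner_sum.
  rewrite (bigD1 i) //= [X in _ - (_ + X)]big1 => [|j ji]; last first.
    by rewrite hornerZ QdE eq_sym (negPf ji) mulr0.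
  rewrite hornerZ QdE eqxx /Q horner_prod [X in _ - X - _](bigD1 i) //=.
  rewrite !hornerE subrr mul0r subr0 divfK ?subrr // prodf_seq_neq0.
  apply/allP => j _; apply/implyP => ji.
  by rewrite subr_eq0 (inj_eq inj_a) eq_sym.
- by rewrite map_inj_uniq ?enum_uniq.
- rewrite size_map size_enum_ord.
  apply: (leq_trans (size_polyD _ _)); rewrite geq_max; apply/andP; split.
    apply/leq_sizeP => i; rewrite coefB leq_eqVlt => /orP[/eqP <-|ni].
      have -> : P`_n = lead_coef P by rewrite lead_coefE sizeP.
      have -> : Q`_n = lead_coef Q by rewrite lead_coefE sizeQ.
      by rewrite (monicP monP) (monicP monQ) subrr.
    by rewrite !nth_default ?subrr ?sizeP ?sizeQ.
  rewrite size_polyN; apply: (leq_trans (size_sum _ _ _)).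
  apply/bigmax_leqP => j _; apply: (leq_trans (size_scale_leq _ _)).
  have QE : Q = ('X - (a j)%:P) * Qd j by rewrite /Q (bigD1 j).
  rewrite -/(Qd j) -ltnS -sizeQ QE.
  rewrite size_monicM ?monicXsubC ?size_XsubC ?addSn //.
  by rewrite monic_neq0 ?monic_prod_XsubC.
Qed.

(** Differentiating P/Q = 1 + sum of r_j/(X - a_j) twice gives twice the sum of r_j/(x - a_j)^3. The
    right-hand side is Q (P/Q)'' by the Leibniz rule, since (1/Q)' = -[h 1]/Q and (1/Q)'' = ([h 1]^2
    + [h 2])/Q. *)
Lemma sum_residue_cube (F : fieldType) (n : nat) (a : 'I_n -> F)
    (P : {poly F}) (x : F) :
    injective a -> P \is monic -> size P = n.+1 ->
    (forall i, x - a i != 0) ->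
  let h l := \sum_(i < n) (x - a i) ^- l in
  2%:R * (\prod_(i < n) (x - a i))
  * \sum_(j < n) P.[a j] / (\prod_(i < n | i != j) (a j - a i))
                 * (x - a j) ^- 3
  = P^`()^`().[x] - 2%:R * h 1%N * P^`().[x] + (h 1%N ^+ 2 + h 2%N) * P.[x].
Proof.
move=> inj_a monP sizeP xa h.
(* [phi p] is [Q] times the second derivative of [p / Q] at [x], where
   [Q := \prod_i ('X - a i)]. *)
pose phi (p : {poly F}) :=
  p^`()^`().[x] - 2%:R * h 1%N * p^`().[x] + (h 1%N ^+ 2 + h 2%N) * p.[x].
have phiD : {morph phi : p q / p + q}.
  by move=> p q; rewrite /phi !derivD !hornerD; ring.
have phi0 : phi 0 = 0 by rewrite /phi !deriv0 horner0; ring.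
have [Q1 Q2] :=
  @horner_deriv_prod_XsubC _ _ (index_enum 'I_n) xpredT a x (fun i _ => xa i).
rewrite -[RHS]/(phi P) (partial_fractions_monic inj_a monP sizeP) phiD.
rewrite (big_morph phi phiD phi0).
set Q := \prod_(i < n) ('X - (a i)%:P) in Q1 Q2 *.
rewrite {1}/phi Q1 Q2 -!/(h _).
have -> : \prod_(i < n) (x - a i) = Q.[x].
  by rewrite horner_prod; apply: eq_bigr => i _; rewrite !hornerE.
(* [phi Q] vanishes, as Q/Q = 1 is constant. *)
rewrite mulr_sumr [X in _ = X + _](_ : _ = 0) ?add0r; last by ring.
(* The expansion of [P] also reached [P.[a j]] on the left; it is folded back there. *)
rewrite -partial_fractions_monic //.
apply: eq_bigr => j _; move: (P.[a j] / _) => c.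
have [D1 D2] := @horner_deriv_prod_XsubC _ _ (index_enum 'I_n)
  (fun i => i != j) a x (fun i _ => xa i).
have hd l : \sum_(i < n | i != j) (x - a i) ^- l = h l - (x - a j) ^- l.
  by rewrite /h [in RHS](bigD1 j) //= addrAC subrr add0r.
rewrite /phi !derivZ !hornerZ D1 D2 !hd.
have -> : Q = ('X - (a j)%:P) * \prod_(i < n | i != j) ('X - (a i)%:P).
  by rewrite /Q (bigD1 j).
rewrite hornerM hornerXsubC !hornerE expr1 /=.
move: (\prod_(i < n | i != j) _).[x] (x - a j) (xa j) => q s s0.
by field.
Qed.

(** * Pochhammer symbols and binomials *)

Definition rising (F : nzRingType) (w : F) (n : nat) : F :=
  \prod_(i < n) (w + i%:R).

Lemma risingD (F : nzRingType) (w : F) (m n : nat) :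
  rising w (m + n) = rising w m * rising (w + m%:R) n.
Proof.
rewrite /rising big_split_ord; congr (_ * _).
by apply: eq_bigr => i _; rewrite natrD addrA.
Qed.

Lemma rising_recr (F : nzRingType) (w : F) (n : nat) :
  rising w n.+1 = rising w n * (w + n%:R).
Proof. by rewrite /rising big_ord_recr. Qed.

Lemma rising_recl (F : nzRingType) (w : F) (n : nat) :
  rising w n.+1 = w * rising (w + 1) n.
Proof. by rewrite -add1n risingD /rising big_ord1 addr0. Qed.

Lemma rising_neq0 (F : fieldType) (w : F) (n : nat) :
  (forall i, (i < n)%N -> w + i%:R != 0) -> rising w n != 0.
Proof.
by move=> w0; apply/prodf_neq0 => i _; apply: w0.
Qed.

Lemma rising_rev (F : comNzRingType) (w : F) (n : nat) :
  rising w n = \prod_(i < n) (w + n%:R - 1 - i%:R).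
Proof.
rewrite /rising (reindex_inj rev_ord_inj); apply: eq_bigr => i _ /=.
by rewrite natrB // -addn1 natrD; ring.
Qed.

Lemma gbinom_rising (F : numFieldType) (u : F) (n : nat) :
  gbinom (u + n%:R) n = rising (u + 1) n / n`!%:R.
Proof.
rewrite rising_rev; congr (_ / _); apply: eq_bigr => i _; ring.
Qed.

(** The factors with j < i give (-1)^i i!, those with j > i give (N-i-1)!. This evaluates Q' at the
    equally spaced roots of Q. The induction on [N] starts, for each i, at N = i + 1. *)
Lemma prod_diff_nat (F : comNzRingType) (N i : nat) : (i < N)%N ->
  \prod_(j < N | j != i :> nat) (j%:R - i%:R) =
  (-1) ^+ i * (i`! * (N - i.+1)`!)%:R :> F.
Proof.
elim: N => // N IH; rewrite ltnS leq_eqVlt => /orP[/eqP <-|iN].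
  rewrite big_mkcond big_ord_recr /= eqxx mulr1 subnn muln1.
  rewrite (eq_bigr (fun j : 'I_i => (-1) * (i - j)%:R)) => [|j _]; last first.
    by rewrite ltn_eqF //= natrB ?(ltnW (ltn_ord j)) //; ring.
  rewrite big_split /= prodr_const card_ord; congr (_ * _).
  rewrite (reindex_inj rev_ord_inj) -natr_prod fact_prod big_add1 big_mkord.
  by congr (_%:R); apply: eq_bigr => j _ /=; rewrite subKn.
rewrite big_mkcond big_ord_recr -big_mkcond /= IH // gtn_eqF //.
rewrite subSS -(subnSK iN) factS -natrB ?(ltnW iN) // -(subnSK iN) !natrM.
by ring.
Qed.

(** Summation by parts, the increments of [gharm] being the (x+i+1)^-l. The term k = 0 is zero
    because H_0 = 0, so the differences of [t] match [c] from index 1 on. *)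
Lemma abel_gharm (F : numFieldType) (l N : nat) (x : F) (c t : nat -> F) :
    (forall k, (k < N)%N -> c k.+1 = t k - t k.+1) ->
  \sum_(0 <= k < N.+1) c k * gharm l k x
  = \sum_(i < N) t i * (x + i.+1%:R) ^- l - t N * gharm l N x.
Proof.
elim: N => [|N IH] ct.
  by rewrite big_nat1 big_ord0 /gharm big_geq // !mulr0 subr0.
rewrite big_nat_recr // IH => [|k kN]; last by rewrite ct // ltnW.
rewrite ct // big_ord_recr /=.
have -> : gharm l N.+1 x = gharm l N x + (x + N.+1%:R) ^- l.
  by rewrite /gharm big_nat_recr //= div1r.
ring.
Qed.

(** * Gosper summation of the summand *)

Section Summand.

Variables (F : numFieldType) (m : nat) (y : F).
Hypotheses (yB : forall i, (i < m.+2)%N -> y - i%:R != 0)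
  (yD : forall i, (i <= m.+2)%N -> y + i%:R != 0).

(** Splitting (y-m-1)_(k+m+2) after k factors and after m+2 factors relates the four Pochhammer
    symbols involved. The resulting form has a denominator free of k, which makes telescoping
    visible. *)
Lemma summand_rising (k : nat) : (k <= m.+2)%N ->
  gbinom (y + k%:R) k / gbinom (y - m.+2%:R + k%:R) k
  * (((y - 1) * y) / ((y + k%:R - 1) * (y + k%:R)))
  = rising (y - m.+1%:R + k%:R) m / rising (y - m.+1%:R) m.
Proof.
move=> kn; rewrite !gbinom_rising.
have -> : y - m.+2%:R + 1 = y - m.+1%:R by rewrite -[m.+2]addn1 natrD; ring.
have nz j : (j <= m.+2)%N -> rising (y - m.+1%:R) j != 0.
  move=> jn; apply: rising_neq0 => i ij.
  have -> : y - m.+1%:R + i%:R = y - (m.+1 - i)%:R.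
    by rewrite natrB; [ring | lia].
  by apply: yB; lia.
have y0 : y != 0 by rewrite -[y]subr0; move: (@yB 0%N isT).
have y1 : y - 1 != 0 by move: (@yB 1%N isT).
have yk : y + k%:R != 0 by apply: yD.
have yk1 : y + k%:R - 1 != 0.
  case: k kn {yk} => [|k] kn; first by rewrite addr0; move: (@yB 1%N isT).
  by rewrite -addn1 natrD addrA addrK; apply: yD; lia.
have k0 : k`!%:R != 0 :> F by rewrite pnatr_eq0 -lt0n fact_gt0.
have := risingD (y - m.+1%:R) m.+2 k; rewrite addnC risingD !rising_recr.
have -> : y - m.+1%:R + m.+2%:R = y + 1 by rewrite -[m.+2]addn1 natrD; ring.
have -> : y - m.+1%:R + m%:R = y - 1 by rewrite -[m.+1]addn1 natrD; ring.
have -> : y - m.+1%:R + m.+1%:R = y by ring.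
have -> : y - m.+1%:R + k%:R + m%:R = y + k%:R - 1.
  by rewrite -[m.+1]addn1 natrD; ring.
have -> : y - m.+1%:R + k%:R + m.+1%:R = y + k%:R by ring.
have := nz m (leq_trans (leqnSn _) (leqnSn _)); have := nz k kn.
move: (rising _ m) (rising _ m) (rising _ k) (rising _ k) => A B C D.
move=> D0 B0 E.
have -> : C = D * (A * (y + k%:R - 1) * (y + k%:R)) / (B * (y - 1) * y).
  by rewrite E; field; rewrite B0 y0 y1.
by field; rewrite B0 y0 y1 yk yk1 D0 k0.
Qed.

(* Closed form of the sum of the summands (without the harmonic factor) of
   index greater than [i], found by Gosper's algorithm. *)
Definition summand_tail (i : nat) : F :=
  - ((-1) ^+ i.+1 * 'C(m.+1, i)%:R * (i%:R - m.+1%:R * y)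
     * rising (y - m.+1%:R + i%:R) m.+1)
  / (m.+1%:R * y * (y - 1) * rising (y - m.+1%:R) m).

Lemma summand_tailB (i : nat) : (i < m.+2)%N ->
  (-1) ^+ i.+1 * 'C(m.+2, i.+1)%:R
  * (rising (y - m.+1%:R + i.+1%:R) m / rising (y - m.+1%:R) m)
  = summand_tail i - summand_tail i.+1.
Proof.
move=> im.
have y0 : y != 0 by rewrite -[y]subr0; move: (@yB 0%N isT).
have y1 : y - 1 != 0 by move: (@yB 1%N isT).
have D0 : rising (y - m.+1%:R) m != 0.
  apply: rising_neq0 => j jm.
  have -> : y - m.+1%:R + j%:R = y - (m.+1 - j)%:R.
    by rewrite natrB; [ring | lia].
  by apply: yB; lia.
have i0 : i%:R + 1 != 0 :> F by rewrite natr1 pnatr_eq0.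
have m0 : m%:R + 1 != 0 :> F by rewrite natr1 pnatr_eq0.
have C1 : 'C(m.+1, i.+1)%:R
    = 'C(m.+1, i)%:R * (m%:R + 1 - i%:R) / (i%:R + 1) :> F.
  apply: (mulIf i0); rewrite divfK // !natr1 -natrB // -!natrM.
  by rewrite mulnC mul_bin_left mulnC.
have C2 : 'C(m.+2, i.+1)%:R
    = 'C(m.+1, i)%:R * (m%:R + 2%:R) / (i%:R + 1) :> F.
  by rewrite binS natrD C1; field.
(* Peeling the first factor in the tail at i and the last one in the tail at i+1 leaves the same
   Pochhammer symbol in all three terms; the rest is a rational identity. *)
rewrite /summand_tail C1 C2 (rising_recl (y - m.+1%:R + i%:R)).
rewrite (rising_recr (y - m.+1%:R + i.+1%:R)).
have -> : y - m.+1%:R + i%:R + 1 = y - m.+1%:R + i.+1%:R.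
  by rewrite -[i.+1]addn1 natrD addrA.
move: (rising _ m) (rising _ m) D0 => W D D0.
rewrite !exprS -[m.+1]addn1 -[i.+1]addn1 !natrD.
by field; rewrite m0 i0 y0 y1 D0.
Qed.

End Summand.

(** * Assembly: tails as residues, then evaluation at x *)

Theorem theorem18 (R : realType) (n : nat) (x y : R[i])
  (hn : (2 <= n)%N)
  (hx : forall j : nat, (1 <= j <= n)%N -> x <> - j%:R)
  (hxy : forall j : nat, (1 <= j <= n)%N -> x - y <> - j%:R)
  (hny : 1 + x - y + n%:R * y <> 0)
  (hy : forall m : int, - n%:Z <= m <= n%:Z - 1 -> y <> m%:~R) :
  \sum_(0 <= k < n.+1)
     (-1) ^+ k * ('C(n, k))%:R
     * (gbinom (y + k%:R) k / gbinom (y - n%:R + k%:R) k)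
     * (((y - 1) * y) / ((y + k%:R - 1) * (y + k%:R)))
     * gharm 3 k x
  = ((-1) ^+ n * (1 + x - y + n%:R * y))
      / (2%:R * n%:R * (n%:R - 1) * (1 + x - y))
    * (gbinom (x - y + n%:R) n / (gbinom (x + n%:R) n * gbinom y n))
    * (A_term n x y + B_term n x y).
Proof.
case: n hn hx hxy hny hy => [|[|m]] // _ hx hxy /eqP hny hy.
have yB i : (i < m.+2)%N -> y - i%:R != 0.
  move=> im; rewrite subr_eq0; apply/eqP; apply: (hy i%:Z).
  by lia.
have yD i : (i <= m.+2)%N -> y + i%:R != 0.
  move=> im; rewrite addr_eq0; apply/eqP; have := hy (- i%:Z).
  by rewrite mulrNz; apply; lia.
have xD i : (i < m.+2)%N -> x + i.+1%:R != 0.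
  by move=> im; rewrite addr_eq0; apply/eqP; apply: hx.
have xyD i : (i < m.+2)%N -> x - y + i.+1%:R != 0.
  by move=> im; rewrite addr_eq0; apply/eqP; apply: hxy.
set D := rising (y - m.+1%:R) m.
have y0 : y != 0 by rewrite -[y]subr0; move: (@yB 0%N isT).
have y1 : y - 1 != 0 by move: (@yB 1%N isT).
have D0 : D != 0.
  apply: rising_neq0 => j jm.
  have -> : y - m.+1%:R + j%:R = y - (m.+1 - j)%:R.
    by rewrite natrB; [ring | lia].
  by apply: yB; lia.
under eq_big_nat => k /andP[_ km].
  rewrite -(mulrA (_ * _) (_ / _) (_ / _)) (summand_rising yB yD) //.
  over.
rewrite (abel_gharm (N := m.+2) _ _ (t := summand_tail m y)); last first.
  by move=> k km; apply: summand_tailB.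
(* The boundary term vanishes because C(m+1, m+2) = 0. *)
have -> : summand_tail m y m.+2 = 0.
  by rewrite /summand_tail bin_small // !(mulr0, mul0r) oppr0 mul0r.
rewrite mul0r subr0.
(* The roots of Q and of P. Index 0 of [b] is the root of 1+X-y+ny, and index k'+1 that of
   X-y+(k'+2), so P is monic of the same degree n as Q. *)
pose a (i : 'I_m.+2) : R[i] := - i.+1%:R.
pose b (k : 'I_m.+2) : R[i] :=
  if val k is k'.+1 then y - k'.+2%:R else y - 1 - m.+2%:R * y.
pose P := \prod_(k < m.+2) ('X - (b k)%:P).
have monP : P \is monic by apply: monic_prod_XsubC.
have sizeP : size P = m.+3.
  by rewrite size_prod_XsubC /index_enum -enumT size_enum_ord.
have inj_a : injective a.
  by move=> i j /oppr_inj/eqP; rewrite eqr_nat eqSS => /eqP/val_inj.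
have xa i : x - a i != 0 by rewrite opprK xD.
(* The product of the [a i - a j] is Q'(a_i) = (-1)^i i! (m+1-i)!, and its inverse is the source of
   the binomial C(m+1, i), up to sign and (m+1)!. *)
have tailE (i : 'I_m.+2) : summand_tail m y i =
    (-1) ^+ m * m.+1`!%:R / (m.+1%:R * y * (y - 1) * D)
    * (P.[a i] / \prod_(j < m.+2 | j != i) (a i - a j)).
  have -> : \prod_(j < m.+2 | j != i) (a i - a j)
      = (-1) ^+ i * (i`! * (m.+2 - i.+1)`!)%:R.
    rewrite -prod_diff_nat //; apply: eq_bigr => j _.
    by rewrite /a -!natr1; ring.
  have -> : P.[a i] = (m.+1%:R * y - i%:R)
      * ((-1) ^+ m.+1 * rising (y - m.+1%:R + i%:R) m.+1).
    rewrite horner_prod big_ord_recl hornerXsubC; congr (_ * _).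
      by rewrite /a /b /= -!natr1; ring.
    rewrite rising_rev -[X in _ ^+ X]card_ord -prodr_const -big_split /=.
    apply: eq_bigr => k _; rewrite hornerXsubC /a /b /=.
    by rewrite -!natr1; ring.
  have f0 : (i`! * (m.+1 - i)`!)%:R != 0 :> R[i].
    by rewrite pnatr_eq0 -lt0n muln_gt0 !fact_gt0.
  have -> : m.+1`!%:R = 'C(m.+1, i)%:R * (i`! * (m.+1 - i)`!)%:R :> R[i].
    by rewrite -natrM bin_fact // -ltnS.
  rewrite /summand_tail subSS -/D; move: (rising _ _) f0 => W.
  move: (_ * _)%:R => f f0.
  have: m.+1%:R != 0 :> R[i] by rewrite pnatr_eq0.
  move: m.+1%:R => M M0.
  (* Only the parities of m and i matter; after the case split the signs are constants that [field]
     can handle. *)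
  rewrite !exprS -(signr_odd _ m) -(signr_odd _ i).
  by case: (odd m); case: (odd i); rewrite /= ?expr1 ?expr0; field;
    rewrite M0 y0 y1 D0 f0.
set v := 1 + x - y + m.+2%:R * y.
set u := 1 + x - y.
have v0 : v != 0 := hny.
have u0 : u != 0 by rewrite /u -addrA addrC; move: (@xyD 0%N isT).
have xb k : x - b k != 0.
  case: k => [[|k] km] /=; rewrite /b /=.
    by move: hny; congr (_ != 0); ring.
  by have := xyD k.+1 km; congr (_ != 0); ring.
have gE l z : gharm l m.+2 z = \sum_(i < m.+2) (z + i.+1%:R) ^- l.
  rewrite /gharm big_add1 big_mkord.
  by apply: eq_bigr => i _; rewrite div1r.
(* P lacks the factor X-y+1, whose value at x is [u], and has instead the factor with value [v];
   hence the two corrections to the harmonic number of x-y. *)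
have hb l : \sum_(k < m.+2) (x - b k) ^- l
    = v ^- l + gharm l m.+2 (x - y) - u ^- l.
  rewrite gE [LHS]big_ord_recl [in RHS]big_ord_recl /=.
  have -> : x - b ord0 = v by rewrite /b /v /=; ring.
  have -> : x - y + 1%:R = u by rewrite /u; ring.
  rewrite [u ^- l + _]addrC addrA addrK; congr (_ + _).
  by apply: eq_bigr => k _; rewrite /b /bump /= add1n; congr (_ ^- _); ring.
have Px : P.[x] = v * rising (x - y + 1) m.+2 / u.
  rewrite horner_prod big_ord_recl hornerXsubC rising_recl -mulrA.
  congr (_ * _).
    by rewrite /b /v /=; ring.
  have -> : x - y + 1 = u by rewrite /u; ring.
  rewrite mulrAC divff // mul1r; apply: eq_bigr => k _.
  by rewrite hornerXsubC /b /u /= -!natr1; ring.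
have Qx : \prod_(i < m.+2) (x - a i) = rising (x + 1) m.+2.
  by apply: eq_bigr => i _; rewrite /a -natr1; ring.
have X0 : rising (x + 1) m.+2 != 0.
  by rewrite -Qx; apply/prodf_neq0 => i _.
have gbinom_y : gbinom y m.+2 = D * (y - 1) * y / m.+2`!%:R.
  rewrite -{1}[y](subrK m.+2%:R) gbinom_rising.
  have -> : y - m.+2%:R + 1 = y - m.+1%:R by rewrite -!natr1; ring.
  by rewrite !rising_recr -/D -!natr1; congr (_ * _ * _ / _); ring.
have [P1 P2] := horner_deriv_prod_XsubC (index_enum 'I_m.+2) (A := xpredT)
  (fun i _ => xb i).
have := sum_residue_cube inj_a monP sizeP xa.
rewrite /= -/P in P1 P2 *.
have ha l : \sum_(i < m.+2) (x - a i) ^- l = gharm l m.+2 x.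
  by rewrite gE; apply: eq_bigr => i _; rewrite opprK.
rewrite P1 P2 !hb !ha Px Qx => S_eq.
rewrite (eq_bigr (fun i : 'I_m.+2 =>
  (-1) ^+ m * m.+1`!%:R / (m.+1%:R * y * (y - 1) * D)
  * (P.[a i] / \prod_(j < m.+2 | j != i) (a i - a j) * (x - a i) ^- 3)));
  last by move=> i _; rewrite tailE [RHS]mulrA opprK.
rewrite -mulr_sumr !gbinom_rising gbinom_y /A_term /B_term -/u -/v.
(* Since v - u = ny, the extra fractions in [A_term] and [B_term] become functions of [u] and [v]
   alone, matching the corrections in [hb]. *)
have nyE : 2%:R * m.+2%:R * y = 2%:R * (v - u) :> R[i] by rewrite /v /u; ring.
have n1 : m.+2%:R - 1 = m.+1%:R :> R[i] by rewrite -natr1 addrK.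
have n0 : m.+2%:R != 0 :> R[i] by rewrite pnatr_eq0.
have n10 : m.+1%:R != 0 :> R[i] by rewrite pnatr_eq0.
have f0 : m.+1`!%:R != 0 :> R[i] by rewrite pnatr_eq0 -lt0n fact_gt0.
rewrite nyE n1 (factS m.+1) natrM !exprS expr0 mulr1.
move: (\sum_(_ < _) _) S_eq => S.
move: (gharm 1 _ x) (gharm 1 _ (x - y)) (gharm 2 _ x) (gharm 2 _ (x - y)).
move: (rising (x + 1) _) (rising (x - y + 1) _) X0 => X Y X0 h1 g1 h2 g2.
move: m.+2%:R m.+1%:R m.+1`!%:R ((-1) ^+ m) n0 n10 f0 => N M f s N0 M0 f0.
rewrite !expr1; clearbody u v D.
(* The residue identity is solved for the sum [S]; what remains is a rational identity in the
   abstracted quantities. *)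
move=> /(canRL (mulKf _)) ->; last by rewrite mulf_neq0 ?pnatr_eq0.
by field; rewrite v0 N0 M0 f0 X0 u0 y0 y1 D0.
Qed.
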